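(* Let $\beta,\kappa_{1,1},\kappa_{1,2},\kappa_{5,1},\kappa_{6,1},\kappa_{6,2},a_1,a_2,e_1,f_1,f_2$ be the real constants of Romik's ambidextrous sofa (Conway's car), i.e. real numbers with the values listed in the context. Let $(X(\alpha),Y(\alpha))$ be the corresponding trajectory of the interior corner $A$ given piecewise in the context, and define $r,t$ by $$r(\alpha)\cos\alpha=X(\alpha),\qquad t(\alpha)\sin\alpha=Y(\alpha).$$ Then $(r,t)$ satisfies the Euler--Lagrange equations $\mathrm{ODE1}=0$ and $\mathrm{ODE2}=0$ of the area functional for the car problem on each of the intervals $0<\alpha<2\beta$ and $2\beta<\alpha<\pi/2$, where (with $r,t$ and their derivatives evaluated at $\alpha$): (i) for $0<\alpha<2\beta$, $$\begin{aligned}\mathrm{ODE1}={}&1+8\sin\tfrac{3\alpha}{2}\,r-8\sin\tfrac{3\alpha}{2}\,t+4\cos\tfrac{\alpha}{2}\,r'-12\cos\tfrac{3\alpha}{2}\,r'+4\cos\tfrac{\alpha}{2}\,t'+12\cos\tfrac{3\alpha}{2}\,t'\\&+4\sin\tfrac{\alpha}{2}\,r''-4\sin\tfrac{3\alpha}{2}\,r''+4\sin\tfrac{\alpha}{2}\,t''+4\sin\tfrac{3\alpha}{2}\,t'',\end{aligned}$$ $$\begin{aligned}\mathrm{ODE2}={}&\cos\tfrac{\alpha}{2}+4(\sin\alpha+\sin2\alpha)\,r-4(\sin\alpha+\sin2\alpha)\,t+2r'-4\cos\alpha\, r'-6\cos2\alpha\, r'\\&+2t'+8\cos\alpha\, t'+6\cos2\alpha\,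 t'-2\sin2\alpha\, r''+4\sin\alpha\, t''+2\sin2\alpha\, t'';\end{aligned}$$ (ii) for $2\beta<\alpha<\pi/2$, $$\mathrm{ODE1}=-\cos\tfrac{\alpha}{2}+\sin\tfrac{\alpha}{2}+8\cos\alpha\, r-6\cos\alpha\, t+16\sin\alpha\, r'-6\sin\alpha\, t'-8\cos\alpha\, r'',$$ $$\mathrm{ODE2}=\cos\tfrac{\alpha}{2}+\sin\tfrac{\alpha}{2}+6\sin\alpha\, r-8\sin\alpha\, t-6\cos\alpha\, r'+16\cos\alpha\, t'+8\sin\alpha\, t''.$$
   Context: Background. Conway's car (ambidextrous sofa) problem asks for a shape of maximal area that can be moved around both left and right right-angled corners in a hallway of unit width. The hallway is rotated relative to the shape with parameter $\alpha$, and its interior corner $A$ has coordinates $(r(\alpha)\cos\alpha,\ t(\alpha)\sin\alpha)$. Assuming symmetry about $\alpha=\pi/2$, the area is an integral functional $\int_0^{\pi/2}F\,d\alpha$ (up to a constant factor) with piecewise integrand $F$ depending on $r,t,r',t',r'',t''$. The necessary conditions for maximal area are the Euler--Lagrange equations $\frac{\partial F}{\partial r}-\frac{d}{d\alpha}\frac{\partial F}{\partial r'}+\frac{d^2}{d\alpha^2}\frac{\partial F}{\partial r''}=0$ (ODE1 $=0$) and the same with $t$ in place of $r$ (ODE2 $=0$). For the statement, ODE1 and ODE2 are the explicit expressions given in the claim (nonvanishing common prefactors have been dropped). Trajectory of $A$ for Romik's car (Romik's parameter equals $\alpha/2$; the curve is translated horizontally). Define $$\mathbf x_1(s)=\Big(\kappa_{1,1}-\sin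 s\,(a_1\sin s-a_2\cos s-\tfrac12)+\cos s\,(a_1\cos s+a_2\sin s-1),\ \ \kappa_{1,2}+\cos s\,(a_1\sin s-a_2\cos s-\tfrac12)+\sin s\,(a_1\cos s+a_2\sin s-1)\Big),$$ $$\mathbf x_6(s)=\Big(\kappa_{6,1}-\sin s\,(f_1\sin\tfrac s2-f_2\cos\tfrac s2-1)+\cos s\,(f_1\cos\tfrac s2+f_2\sin\tfrac s2-1),\ \ \kappa_{6,2}+\cos s\,(f_1\sin\tfrac s2-f_2\cos\tfrac s2-1)+\sin s\,(f_1\cos\tfrac s2+f_2\sin\tfrac s2-1)\Big).$$ Then $$(X(\alpha),Y(\alpha))=\mathbf x_j(\alpha/2)-\Big(\tfrac12(1-e_1+\kappa_{5,1}),\,0\Big),$$ with $j=1$ for $0<\alpha<2\beta$ and $j=6$ for $2\beta<\alpha<\pi/2$. Constants. $\kappa_{1,2}=\kappa_{6,2}=\tfrac12$, $a_2=0$, and the others are real numbers having the following values (to within $10^{-20}$): $\beta=0.289653820817320941743521611736$, $\kappa_{1,1}=0.124712637587267758739932415305$, $\kappa_{6,1}=-0.167049816550309655013423446260$, $\kappa_{5,1}=-0.458812270687887068766779307825$, $a_1=e_1=0.875287362412732241260067584695$, $f_1=1.202938908156911389070222800034$, $f_2=-0.498273610464875672029397859080$. *)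

(* Defs.v *)
From Stdlib Require Export Reals.
From Coquelicot Require Export Coquelicot.
Open Scope R_scope.

Record car_constants : Set := CarConstants {
  beta : R;
  kappa11 : R; kappa12 : R;
  kappa51 : R;
  kappa61 : R; kappa62 : R;
  a1 : R; a2 : R;
  e1 : R;
  f1 : R; f2 : R
}.

Definition agrees_to_20 (x v : R) : Prop := Rabs (x - v) <= 1e-20.

(* The relations stated with [=] are exact; the remaining constants are known
   only through their decimal expansions, accurate to within 10^-20. *)
Definition is_romik_car (c : car_constants) : Prop :=
  kappa12 c = 1 / 2 /\
  kappa62 c = 1 / 2 /\
  a2 c = 0 /\
  a1 c = e1 c /\
  agrees_to_20 (beta c) 0.289653820817320941743521611736 /\
  agrees_to_20 (kappa11 c) 0.124712637587267758739932415305 /\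
  agrees_to_20 (kappa61 c) (-0.167049816550309655013423446260) /\
  agrees_to_20 (kappa51 c) (-0.458812270687887068766779307825) /\
  agrees_to_20 (a1 c) 0.875287362412732241260067584695 /\
  agrees_to_20 (f1 c) 1.202938908156911389070222800034 /\
  agrees_to_20 (f2 c) (-0.498273610464875672029397859080).

Definition x1 (c : car_constants) (s : R) : R * R :=
  (kappa11 c - sin s * (a1 c * sin s - a2 c * cos s - 1 / 2)
             + cos s * (a1 c * cos s + a2 c * sin s - 1),
   kappa12 c + cos s * (a1 c * sin s - a2 c * cos s - 1 / 2)
             + sin s * (a1 c * cos s + a2 c * sin s - 1)).

Definition x6 (c : car_constants) (s : R) : R * R :=
  (kappa61 c - sin s * (f1 c * sin (s / 2) - f2 c * cos (s / 2) - 1)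
             + cos s * (f1 c * cos (s / 2) + f2 c * sin (s / 2) - 1),
   kappa62 c + cos s * (f1 c * sin (s / 2) - f2 c * cos (s / 2) - 1)
             + sin s * (f1 c * cos (s / 2) + f2 c * sin (s / 2) - 1)).

(* Position of the interior corner of the hallway; only the values at
   0 < alpha < 2 beta and 2 beta < alpha < PI / 2 are meaningful. *)
Definition corner (c : car_constants) (alpha : R) : R * R :=
  let p := if Rlt_dec alpha (2 * beta c)
           then x1 c (alpha / 2) else x6 c (alpha / 2) in
  (fst p - 1 / 2 * (1 - e1 c + kappa51 c), snd p).

Definition cornerX (c : car_constants) (alpha : R) : R := fst (corner c alpha).
Definition cornerY (c : car_constants) (alpha : R) : R := snd (corner c alpha).

(* The left-hand sides of the Euler-Lagrange equations for the area functional,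
   up to nonvanishing factors: variation in r gives ODE1, variation in t gives
   ODE2; the suffix is the range of alpha (1: alpha < 2 beta, 2: alpha > 2 beta). *)
Definition ODE1_1 (r t : R -> R) (alpha : R) : R :=
  1 + 8 * sin (3 * alpha / 2) * r alpha
    - 8 * sin (3 * alpha / 2) * t alpha
    + 4 * cos (alpha / 2) * Derive r alpha
    - 12 * cos (3 * alpha / 2) * Derive r alpha
    + 4 * cos (alpha / 2) * Derive t alpha
    + 12 * cos (3 * alpha / 2) * Derive t alpha
    + 4 * sin (alpha / 2) * Derive_n r 2 alpha
    - 4 * sin (3 * alpha / 2) * Derive_n r 2 alpha
    + 4 * sin (alpha / 2) * Derive_n t 2 alpha
    + 4 * sin (3 * alpha / 2) * Derive_n t 2 alpha.

Definition ODE2_1 (r t : R -> R) (alpha : R) : R :=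
  cos (alpha / 2)
    + 4 * (sin alpha + sin (2 * alpha)) * r alpha
    - 4 * (sin alpha + sin (2 * alpha)) * t alpha
    + 2 * Derive r alpha
    - 4 * cos alpha * Derive r alpha
    - 6 * cos (2 * alpha) * Derive r alpha
    + 2 * Derive t alpha
    + 8 * cos alpha * Derive t alpha
    + 6 * cos (2 * alpha) * Derive t alpha
    - 2 * sin (2 * alpha) * Derive_n r 2 alpha
    + 4 * sin alpha * Derive_n t 2 alpha
    + 2 * sin (2 * alpha) * Derive_n t 2 alpha.

Definition ODE1_2 (r t : R -> R) (alpha : R) : R :=
  - cos (alpha / 2) + sin (alpha / 2)
    + 8 * cos alpha * r alpha
    - 6 * cos alpha * t alpha
    + 16 * sin alpha * Derive r alpha
    - 6 * sin alpha * Derive t alpha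
    - 8 * cos alpha * Derive_n r 2 alpha.

Definition ODE2_2 (r t : R -> R) (alpha : R) : R :=
  cos (alpha / 2) + sin (alpha / 2)
    + 6 * sin alpha * r alpha
    - 8 * sin alpha * t alpha
    - 6 * cos alpha * Derive r alpha
    + 16 * cos alpha * Derive t alpha
    + 8 * sin alpha * Derive_n t 2 alpha.

(* [Derive] is total, so that a genuine solution must also be required to be
   twice differentiable. *)
Definition twice_derivable_at (f : R -> R) (x : R) : Prop :=
  ex_derive_n f 1 x /\ ex_derive_n f 2 x.

Definition solves_on (a b : R) (E1 E2 : (R -> R) -> (R -> R) -> R -> R)
    (r t : R -> R) : Prop :=
  forall alpha : R, a < alpha < b ->
    twice_derivable_at r alpha /\ twice_derivable_at t alpha /\
    E1 r t alpha = 0 /\ E2 r t alpha = 0.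

(* Main.v *)
Require Import Defs.
From Stdlib Require Import Lra.

(** Writing X = r cos and Y = t sin, the Euler-Lagrange expressions are affine
    in the derivatives of X and Y alone: with s = alpha / 2,
    - alpha < 2 beta: ODE1 = 1 - 8 sin s (X'' + Y') + 8 cos s (Y'' - X')
      and ODE2 = cos s * ODE1;
    - alpha > 2 beta: ODE1 = - cos s + sin s - 8 X'' - 6 Y'
      and ODE2 = cos s + sin s - 6 X' + 8 Y''.
    They are thus invariant under translations of the trajectory, and they
    vanish on Romik's curves for all values of the remaining constants; the
    decimal values only serve to place 2 beta in (0, PI / 2). *)

(** Near [x], [f] is the quotient [N / D], hence as smooth as [N] and [D]. The two equations are the
    product rule for [f * D = N]; in this division-free form they can be substituted directly into
    the ODEs. The relation is assumed only locally, since [r] and [t] are constrained only on open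
    intervals. *)
Lemma twice_derivable_quotient (f D D1 D2 N N1 N2 : R -> R) (x : R) :
  (forall y, is_derive D y (D1 y)) -> (forall y, is_derive D1 y (D2 y)) ->
  (forall y, is_derive N y (N1 y)) -> (forall y, is_derive N1 y (N2 y)) ->
  D x <> 0 ->
  locally x (fun y => f y * D y = N y) ->
  twice_derivable_at f x /\
  Derive f x * D x + f x * D1 x = N1 x /\
  Derive_n f 2 x * D x + 2 * (Derive f x * D1 x) + f x * D2 x = N2 x.
Proof.
intros HD HD1 HN HN1 Dx0 Hf.
assert (Dnz : locally x (fun y => D y <> 0)).
{ apply (ex_derive_continuous D x (ex_intro _ _ (HD x)) (fun z => z <> 0)).
  exact (open_neq 0 (D x) Dx0). }
assert (Hf1 : locally x
    (fun y => is_derive f y ((N1 y * D y - N y * D1 y) / D y ^ 2))).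
(* The quotient rule is needed on a whole neighbourhood of [x], so that [Derive f] can be
   differentiated again; each nearby [y] has its own neighbourhood where [f = N / D]. *)
{ apply locally_locally in Hf; apply locally_locally in Dnz.
  generalize (filter_and _ _ Hf Dnz); apply filter_imp.
  intros y [fy Dy].
  apply is_derive_ext_loc with (fun z => N z / D z).
  - generalize (filter_and _ _ fy Dy); apply filter_imp.
    intros z [fz Dz]; rewrite <- fz; now apply Rmult_div_l.
  - apply is_derive_div; try easy. exact (locally_singleton _ _ Dy). }
assert (Hdf : locally x
    (fun y => (N1 y * D y - N y * D1 y) / D y ^ 2 = Derive f y)).
{ revert Hf1; apply filter_imp; intros y Hy.
  symmetry; now apply is_derive_unique. }
(* Quotient rule applied twice: the [N1 * D1] terms cancel in the derivative of [N1 * D - N * D1],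
   and one factor [D] has been cancelled. *)
set (f2x := ((N2 x * D x - N x * D2 x) * D x
             - 2 * (N1 x * D x - N x * D1 x) * D1 x) / D x ^ 3).
assert (Hf2 : is_derive (Derive f) x f2x).
{ apply (is_derive_ext_loc _ _ _ _ Hdf).
  evar_last.
  - apply is_derive_div.
    + apply @is_derive_minus; apply @is_derive_mult; try easy; exact Rmult_comm.
    + apply is_derive_pow, HD.
    + now apply pow_nonzero.
  - unfold f2x, minus, plus, opp, mult; simpl; now field. }
assert (fx := locally_singleton _ _ Hf); simpl in fx.
assert (dfx := locally_singleton _ _ Hdf); simpl in dfx.
change (Derive_n f 2 x) with (Derive (Derive f) x).
rewrite (is_derive_unique _ _ _ Hf2).
split; [split|].
- eexists; exact (locally_singleton _ _ Hf1).
- eexists; exact Hf2.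
- rewrite <- dfx; unfold f2x; rewrite <- fx.
  split; now field.
Qed.

Lemma is_derive_cos_opp_sin (y : R) : is_derive cos y (- sin y).
Proof. auto_derive; [easy | ring]. Qed.

Lemma is_derive_opp_sin (y : R) : is_derive (fun z => - sin z) y (- cos y).
Proof. auto_derive; [easy | ring]. Qed.

(** Turns every trigonometric term of the first pair of ODEs into a polynomial in [p] and [q]; the
    first equation, oriented to eliminate [p * p], lets [ring] work modulo the Pythagorean
    identity. *)
Lemma half_angle_formulas (alpha : R) :
  let p := sin (alpha / 2) in let q := cos (alpha / 2) in
  p * p = 1 - q * q /\
  sin alpha = 2 * p * q /\ cos alpha = 2 * q * q - 1 /\
  sin (3 * alpha / 2) = p * (4 * q * q - 1) /\
  cos (3 * alpha / 2) = q * (4 * q * q - 3) /\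
  sin (2 * alpha) = 4 * p * q * (2 * q * q - 1) /\
  cos (2 * alpha) = 2 * (2 * q * q - 1) * (2 * q * q - 1) - 1.
Proof.
intros p q.
assert (pq : p * p = 1 - q * q).
{ unfold p, q; generalize (sin2_cos2 (alpha / 2)); unfold Rsqr; lra. }
assert (s1 : sin alpha = 2 * p * q).
{ unfold p, q; rewrite <- sin_2a; f_equal; field. }
assert (c1 : cos alpha = 2 * q * q - 1).
{ unfold q; rewrite <- cos_2a_cos; f_equal; field. }
replace (3 * alpha / 2) with (alpha + alpha / 2) by field.
rewrite sin_plus, cos_plus, sin_2a, cos_2a_cos, s1, c1; fold p q.
repeat split; try assumption; ring [pq].
Qed.

Lemma ODE_1_corner (r t : R -> R) (alpha X1 X2 Y1 Y2 : R) :
  Derive r alpha * cos alpha + r alpha * - sin alpha = X1 ->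
  Derive_n r 2 alpha * cos alpha + 2 * (Derive r alpha * - sin alpha)
    + r alpha * - cos alpha = X2 ->
  Derive t alpha * sin alpha + t alpha * cos alpha = Y1 ->
  Derive_n t 2 alpha * sin alpha + 2 * (Derive t alpha * cos alpha)
    + t alpha * - sin alpha = Y2 ->
  ODE1_1 r t alpha = 1 - 8 * sin (alpha / 2) * (X2 + Y1)
                       + 8 * cos (alpha / 2) * (Y2 - X1) /\
  ODE2_1 r t alpha = cos (alpha / 2) * ODE1_1 r t alpha.
Proof.
intros <- <- <- <-; unfold ODE1_1, ODE2_1.
destruct (half_angle_formulas alpha) as (pq & -> & -> & -> & -> & -> & ->).
split; ring [pq].
Qed.

Lemma ODE_2_corner (r t : R -> R) (alpha X1 X2 Y1 Y2 : R) :
  Derive r alpha * cos alpha + r alpha * - sin alpha = X1 ->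
  Derive_n r 2 alpha * cos alpha + 2 * (Derive r alpha * - sin alpha)
    + r alpha * - cos alpha = X2 ->
  Derive t alpha * sin alpha + t alpha * cos alpha = Y1 ->
  Derive_n t 2 alpha * sin alpha + 2 * (Derive t alpha * cos alpha)
    + t alpha * - sin alpha = Y2 ->
  ODE1_2 r t alpha = - cos (alpha / 2) + sin (alpha / 2) - 8 * X2 - 6 * Y1 /\
  ODE2_2 r t alpha = cos (alpha / 2) + sin (alpha / 2) - 6 * X1 + 8 * Y2.
Proof.
intros <- <- <- <-; unfold ODE1_2, ODE2_2; split; ring.
Qed.

Lemma x1_eq (c : car_constants) (alpha : R) :
  kappa12 c = 1 / 2 -> a2 c = 0 ->
  x1 c (alpha / 2) =
  (kappa11 c + a1 c * cos alpha + 1 / 2 * sin (alpha / 2) - cos (alpha / 2),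
   1 / 2 + a1 c * sin alpha - 1 / 2 * cos (alpha / 2) - sin (alpha / 2)).
Proof.
intros k a; unfold x1; rewrite k, a.
destruct (half_angle_formulas alpha) as (pq & -> & -> & _).
f_equal; ring [pq].
Qed.

(** The rotation by [alpha / 2] acts on vectors already at angle [alpha / 4], so the angles add up
    to [3 * alpha / 4]. *)
Lemma x6_eq (c : car_constants) (alpha : R) :
  kappa62 c = 1 / 2 ->
  x6 c (alpha / 2) =
  (kappa61 c + f1 c * cos (3 * alpha / 4) + f2 c * sin (3 * alpha / 4)
     + sin (alpha / 2) - cos (alpha / 2),
   1 / 2 + f1 c * sin (3 * alpha / 4) - f2 c * cos (3 * alpha / 4)
     - cos (alpha / 2) - sin (alpha / 2)).
Proof.
intros k; unfold x6; rewrite k.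
replace (3 * alpha / 4) with (alpha / 2 + alpha / 2 / 2) by field.
rewrite sin_plus, cos_plus; f_equal; ring.
Qed.

(** Reduces both intervals to pointwise algebra: within [(0, PI / 2)] the divisors [cos] and [sin]
    are positive, so the quotient lemma applies to [r] and to [t]. *)
Lemma solves_on_corner (a b : R) (E1 E2 : (R -> R) -> (R -> R) -> R -> R)
    (r t X X1 X2 Y Y1 Y2 : R -> R) :
  0 <= a -> b <= PI / 2 ->
  (forall y, is_derive X y (X1 y)) -> (forall y, is_derive X1 y (X2 y)) ->
  (forall y, is_derive Y y (Y1 y)) -> (forall y, is_derive Y1 y (Y2 y)) ->
  (forall y, a < y < b -> r y * cos y = X y /\ t y * sin y = Y y) ->
  (forall y,
    Derive r y * cos y + r y * - sin y = X1 y ->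
    Derive_n r 2 y * cos y + 2 * (Derive r y * - sin y) + r y * - cos y = X2 y ->
    Derive t y * sin y + t y * cos y = Y1 y ->
    Derive_n t 2 y * sin y + 2 * (Derive t y * cos y) + t y * - sin y = Y2 y ->
    E1 r t y = 0 /\ E2 r t y = 0) ->
  solves_on a b E1 E2 r t.
Proof.
intros a0 bP dX dX1 dY dY1 rt E alpha Ha.
assert (L : locally alpha (fun y => a < y < b)).
{ apply filter_and; [apply (open_gt a) | apply (open_lt b)]; apply Ha. }
destruct (twice_derivable_quotient r cos _ _ X X1 X2 alpha
  is_derive_cos_opp_sin is_derive_opp_sin dX dX1) as (Hr & r1 & r2).
{ apply Rgt_not_eq, cos_gt_0; lra. }
{ revert L; apply filter_imp; intros y Hy; now apply rt. }
destruct (twice_derivable_quotient t sin _ _ Y Y1 Y2 alpha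
  is_derive_sin is_derive_cos_opp_sin dY dY1) as (Ht & t1 & t2).
{ apply Rgt_not_eq, sin_gt_0; lra. }
{ revert L; apply filter_imp; intros y Hy; now apply rt. }
split; [exact Hr | split; [exact Ht | now apply E]].
Qed.

Theorem theorem7 (c : car_constants) (r t : R -> R) :
  is_romik_car c ->
  (forall alpha : R,
      0 < alpha < 2 * beta c \/ 2 * beta c < alpha < PI / 2 ->
      r alpha * cos alpha = cornerX c alpha /\
      t alpha * sin alpha = cornerY c alpha) ->
  solves_on 0 (2 * beta c) ODE1_1 ODE2_1 r t /\
  solves_on (2 * beta c) (PI / 2) ODE1_2 ODE2_2 r t.
Proof.
intros (k12 & k62 & a20 & _ & Hb & _) rt.
(* [2 * beta c] is about 0.58, and [1 < PI / 2]. *)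
assert (b_range : 0 < 2 * beta c < PI / 2).
{ unfold agrees_to_20 in Hb; apply Rabs_le_between in Hb.
  generalize PI2_1; lra. }
unfold cornerX, cornerY, corner in rt.
set (h := 1 / 2 * (1 - e1 c + kappa51 c)) in rt.
split.
- apply (solves_on_corner _ _ _ _ r t
    (fun y => kappa11 c + a1 c * cos y + 1 / 2 * sin (y / 2) - cos (y / 2) - h)
    (fun y => - (a1 c * sin y) + 1 / 4 * cos (y / 2) + 1 / 2 * sin (y / 2))
    (fun y => - (a1 c * cos y) - 1 / 8 * sin (y / 2) + 1 / 4 * cos (y / 2))
    (fun y => 1 / 2 + a1 c * sin y - 1 / 2 * cos (y / 2) - sin (y / 2))
    (fun y => a1 c * cos y + 1 / 4 * sin (y / 2) - 1 / 2 * cos (y / 2))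
    (fun y => - (a1 c * sin y) + 1 / 8 * cos (y / 2) + 1 / 4 * sin (y / 2)));
    try lra; try (intros y; auto_derive; [easy | unfold Rdiv; field]).
  + intros y Hy; specialize (rt y (or_introl Hy)).
    destruct Rlt_dec; [|lra]; now rewrite x1_eq in rt.
  + intros y r1 r2 t1 t2.
    destruct (ODE_1_corner r t y _ _ _ _ r1 r2 t1 t2) as [E1 E2].
    assert (E : ODE1_1 r t y = 0).
    (* The [a1] terms cancel in both [X'' + Y'] and [Y'' - X']; what remains is
       [1 - p * p - q * q]. *)
    { rewrite E1; destruct (half_angle_formulas y) as (pq & -> & -> & _).
      field [pq]. }
    split; [exact E | rewrite E2, E; ring].
- apply (solves_on_corner _ _ _ _ r t
    (fun y => kappa61 c + f1 c * cos (3 * y / 4) + f2 c * sin (3 * y / 4)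
                + sin (y / 2) - cos (y / 2) - h)
    (fun y => 3 / 4 * (f2 c * cos (3 * y / 4) - f1 c * sin (3 * y / 4))
                + 1 / 2 * (cos (y / 2) + sin (y / 2)))
    (fun y => - (9 / 16) * (f2 c * sin (3 * y / 4) + f1 c * cos (3 * y / 4))
                + 1 / 4 * (cos (y / 2) - sin (y / 2)))
    (fun y => 1 / 2 + f1 c * sin (3 * y / 4) - f2 c * cos (3 * y / 4)
                - cos (y / 2) - sin (y / 2))
    (fun y => 3 / 4 * (f1 c * cos (3 * y / 4) + f2 c * sin (3 * y / 4))
                + 1 / 2 * (sin (y / 2) - cos (y / 2)))
    (fun y => - (9 / 16) * (f1 c * sin (3 * y / 4) - f2 c * cos (3 * y / 4))
                + 1 / 4 * (cos (y / 2) + sin (y / 2))));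
    try lra; try (intros y; auto_derive; [easy | unfold Rdiv; field]).
  + intros y Hy; specialize (rt y (or_intror Hy)).
    destruct Rlt_dec; [lra|]; now rewrite x6_eq in rt.
  + intros y r1 r2 t1 t2.
    destruct (ODE_2_corner r t y _ _ _ _ r1 r2 t1 t2) as [-> ->].
    (* The [f1] and [f2] terms cancel because [8 * (9 / 16) = 6 * (3 / 4)]; the half-angle terms
       then cancel linearly. *)
    split; field.
Qed.
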